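(* Let $\mathcal H$ be an infinite dimensional separable complex Hilbert space, let $T$ be a bounded linear operator on $\mathcal H$, and let $\alpha$ be a real number with $\alpha>1$. Then the operator $S=T\oplus\alpha I_{\mathbb C}$ on $\mathcal H\oplus\mathbb C$ is diskcyclic if and only if $\frac1\alpha T$ is hypercyclic on $\mathcal H$.
   Context: Here $(T\oplus\alpha I_{\mathbb C})(h\oplus c)=Th\oplus \alpha c$ for $h\in\mathcal H$, $c\in\mathbb C$. A bounded linear operator $A$ on a Hilbert space $\mathcal K$ is hypercyclic if there is $x\in\mathcal K$ with $\{A^n x: n\ge 0\}$ dense in $\mathcal K$. It is diskcyclic if there is $x\in\mathcal K$ with $\{\beta A^n x : n\ge 0,\ \beta\in\mathbb C,\ |\beta|\le 1\}$ dense in $\mathcal K$. *)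

(* Defs.v *)
From HB Require Import structures.
From mathcomp Require Import all_boot all_order all_algebra.
From mathcomp Require Import sesquilinear.
From mathcomp Require Import complex.
From mathcomp Require Import all_classical all_reals all_analysis.

Set Implicit Arguments.
Unset Strict Implicit.
Unset Printing Implicit Defensive.

Import Order.TTheory GRing.Theory Num.Theory.
Import numFieldNormedType.Exports.

Local Open Scope classical_set_scope.
Local Open Scope complex_scope.
Local Open Scope ring_scope.

(* The inner product is linear in its first argument and conjugate-linear in
   the second; positive definiteness is part of {dot _ for _}. *)
HB.mixin Record CompleteNormedModule_isHilbert (R : realType) (H : Type)
    & CompleteNormedModule R[i] H := {
  inner : {dot H for @Num.conj R[i]} ;
  sqr_norm_inner : forall x : H, `|x| ^+ 2 = inner x x
}.

#[short(type="hilbertType")]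
HB.structure Definition Hilbert (R : realType) :=
  {H of CompleteNormedModule R[i] H & CompleteNormedModule_isHilbert R H}.

(* A separate name for R[i]^o, because the completeness instance that the
   library attaches to _^o is the one for real scalars. *)
Definition complex_line (R : realType) : Type := R[i]^o.

HB.instance Definition _ (R : realType) :=
  NormedModule.copy (complex_line R) (R[i]^o).

Section ComplexLine.
Variable R : realType.
Local Notation C := (complex_line R).

Let Re_le (z : R[i]) : `|complex.Re z| <= complex.Re `|z|.
Proof. by have := normc_ge_Re z; rewrite lecE => /andP[]. Qed.

Let Im_le (z : R[i]) : `|complex.Im z| <= complex.Re `|z|.
Proof.
rewrite normc_def /= -sqrtr_sqr ler_sqrt ?lerDr ?sqr_ge0//.
by rewrite addr_ge0 ?sqr_ge0.
Qed.

Let norm_le (z : R[i]) : complex.Re `|z| <= `|complex.Re z| + `|complex.Im z|.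
Proof.
rewrite normc_def /= -[leRHS]ger0_norm ?addr_ge0// -sqrtr_sqr ler_sqrt ?sqr_ge0//.
by rewrite sqrrD !real_normK ?num_real// lerD2r lerDl mulrn_wge0// mulr_ge0.
Qed.

Let cauchy_part (F : set_system C) (f : C -> R) :
  (forall z w : R[i], `|f z - f w| <= complex.Re `|z - w|) ->
  ProperFilter F -> cauchy F -> cvg (f @ F).
Proof.
move=> fle FF /cauchyP Fc; apply/cauchy_cvgP/cauchyP => e e0.
have [|x Fx] := Fc e%:C; first by rewrite ltcR.
exists (f x).
suff sub : ball x e%:C `<=` f @^-1` ball (f x) e by exact: filterS sub Fx.
move=> y; rewrite -ball_normE /= => xy; rewrite -ball_normE /=.
apply: le_lt_trans (fle _ _) _.
by move: xy; rewrite ltcE => /andP[].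
Qed.

Lemma complex_line_complete (F : set_system C) :
  ProperFilter F -> cauchy F -> cvg F.
Proof.
move=> FF Fc.
have /cvg_ex[/= a aF] : cvg ((@complex.Re R : C -> R) @ F).
  by apply: cauchy_part => // -[? ?] [? ?]; apply: (Re_le (Complex _ _)).
have /cvg_ex[/= b bF] : cvg ((@complex.Im R : C -> R) @ F).
  by apply: cauchy_part => // -[? ?] [? ?]; apply: (Im_le (Complex _ _)).
apply/cvg_ex; exists ((a +i* b)%C : C).
apply/cvgrPdist_lt => -[e e'] /=; rewrite ltcE /= => /andP[/eqP-> e0].
have e2 : 0 < e / 2 by rewrite divr_gt0.
move/cvgrPdist_lt : aF => /(_ _ e2) aF.
move/cvgrPdist_lt : bF => /(_ _ e2) bF.
have close (z : R[i]) : `|a - complex.Re z| < e / 2 ->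
    `|b - complex.Im z| < e / 2 -> `|(a +i* b)%C - z| < e%:C.
  case: z => c d /= ac bd; rewrite -[ltLHS]RRe_real ?normr_real// ltcR [ltRHS]splitr.
  by apply: le_lt_trans (norm_le _) _; rewrite ltrD.
by near=> z; apply: close; near: z.
Unshelve. all: by end_near. Qed.

HB.instance Definition _ :=
  Uniform_isComplete.Build (complex_line R) complex_line_complete.

Definition complex_inner (z w : C) : R[i] := (z : R[i]) * Num.conj (w : R[i]).

Lemma complex_inner_bilinear :
  bilinear_for *%R (@Num.conj R[i] \; *%R) complex_inner.
Proof.
split=> [w a z z'|w a z z'] /=; rewrite /complex_inner.
  by rewrite mulrDl mulrA.
by rewrite rmorphD rmorphM mulrDr mulrCA.
Qed.

HB.instance Definition _ := bilinear_isBilinear.Build R[i] C C R[i]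
  *%R (@Num.conj R[i] \; *%R) complex_inner complex_inner_bilinear.

Lemma complex_inner_hermitian (z w : C) :
  complex_inner z w = (-1) ^+ false * Num.conj (complex_inner w z).
Proof. by rewrite /complex_inner mul1r rmorphM /= conjCK mulrC. Qed.

HB.instance Definition _ := isHermitianSesquilinear.Build R[i] C false
  (@Num.conj R[i]) complex_inner complex_inner_hermitian.

Lemma complex_inner_gt0 (z : C) : z != 0 -> 0 < complex_inner z z.
Proof.
move=> z0; rewrite /complex_inner -normCK exprn_gt0// lt_def normr_ge0 andbT.
by apply: contra_neq z0 => /normr0_eq0.
Qed.

HB.instance Definition _ :=
  isDotProduct.Build R[i] C complex_inner complex_inner_gt0.
Lemma sqr_norm_complex_inner (z : C) : `|z| ^+ 2 = complex_inner z z.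
Proof. exact: normCK. Qed.

HB.instance Definition _ :=
  CompleteNormedModule_isHilbert.Build R C sqr_norm_complex_inner.

End ComplexLine.

(* The library's norm on H1 * H2 is the maximum norm, hence the new type. *)
Definition hilbert_sum (R : realType) (H1 H2 : hilbertType R) : Type :=
  (H1 * H2)%type.

HB.instance Definition _ (R : realType) (H1 H2 : hilbertType R) :=
  GRing.Lmodule.copy (hilbert_sum H1 H2) (H1 * H2)%type.

Section HilbertSum.
Variables (R : realType) (H1 H2 : hilbertType R).
Local Notation H := (hilbert_sum H1 H2).

Definition sum_norm (x : H) : R[i] := sqrtC (`|x.1| ^+ 2 + `|x.2| ^+ 2).

Let sum_normE (x : H) : sum_norm x = `| `|x.1| + 'i%R * `|x.2| |.
Proof. by rewrite normC_rect ?normr_real. Qed.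

Let sum_norm_ge0 (x : H) : 0 <= sum_norm x.
Proof. by rewrite sum_normE. Qed.

Let sqr_sum_norm (x : H) : sum_norm x ^+ 2 = `|x.1| ^+ 2 + `|x.2| ^+ 2.
Proof. exact: sqrtCK. Qed.

Lemma sum_norm_le (x : H) : sum_norm x <= `|x.1| + `|x.2|.
Proof.
by rewrite sum_normE (le_trans (ler_normD _ _))// normrM normCi mul1r !normr_id.
Qed.

Lemma fst_le_sum_norm (x : H) : `|x.1| <= sum_norm x.
Proof. by rewrite -(@ler_pXn2r _ 2) ?nnegrE// sqr_sum_norm lerDl exprn_ge0. Qed.

Lemma snd_le_sum_norm (x : H) : `|x.2| <= sum_norm x.
Proof. by rewrite -(@ler_pXn2r _ 2) ?nnegrE// sqr_sum_norm lerDr exprn_ge0. Qed.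

Lemma ler_sum_normD (x y : H) : sum_norm (x + y) <= sum_norm x + sum_norm y.
Proof.
apply: (@le_trans _ _ `|(`|x.1| + `|y.1|) + 'i%R * (`|x.2| + `|y.2|)|).
  rewrite sum_normE -(@ler_pXn2r _ 2) ?nnegrE// !normC2_rect ?rpredD ?normr_real//.
  by rewrite lerD// ler_pXn2r ?nnegrE ?addr_ge0 ?ler_normD.
by rewrite mulrDr addrACA !sum_normE ler_normD.
Qed.

Lemma sum_normZ (a : R[i]) (x : H) : sum_norm (a *: x) = `|a| * sum_norm x.
Proof.
by rewrite !sum_normE /= !normrZ mulrCA -mulrDr normrM normr_id.
Qed.

Lemma sum_norm_eq0 (x : H) : sum_norm x = 0 -> x = 0.
Proof.
move=> x0; have [x1 x2] : x.1 = 0 /\ x.2 = 0.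
  split; apply/eqP; rewrite -normr_le0 -x0.
  - exact: fst_le_sum_norm.
  - exact: snd_le_sum_norm.
by case: x x1 x2 {x0} => ? ? /= -> ->.
Qed.

HB.instance Definition _ :=
  Lmodule_isNormed.Build R[i] H ler_sum_normD sum_normZ sum_norm_eq0.

Let cauchy_part (H' : hilbertType R) (F : set_system H) (f : H -> H') :
  (forall x y : H, `|f x - f y| <= `|x - y|) ->
  ProperFilter F -> cauchy F -> cvg (f @ F).
Proof.
move=> fle FF /cauchyP Fc; apply/cauchy_cvgP/cauchyP => e e0.
have [x Fx] := Fc e e0; exists (f x).
suff sub : ball x e `<=` f @^-1` ball (f x) e by exact: filterS sub Fx.
move=> y; rewrite -ball_normE /= => xy; rewrite -ball_normE /=.
exact: le_lt_trans (fle _ _) xy.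
Qed.

Lemma hilbert_sum_complete (F : set_system H) :
  ProperFilter F -> cauchy F -> cvg F.
Proof.
move=> FF Fc.
have /cvg_ex[/= a aF] : cvg ((fst : H -> H1) @ F).
  by apply: cauchy_part => // x y; exact: (fst_le_sum_norm (x - y)).
have /cvg_ex[/= b bF] : cvg ((snd : H -> H2) @ F).
  by apply: cauchy_part => // x y; exact: (snd_le_sum_norm (x - y)).
apply/cvg_ex; exists ((a, b) : H); apply/cvgrPdist_lt => e e0.
have e2 : 0 < e / 2 by rewrite divr_gt0.
move/cvgrPdist_lt : aF => /(_ _ e2) aF.
move/cvgrPdist_lt : bF => /(_ _ e2) bF.
have close (x : H) : `|a - x.1| < e / 2 -> `|b - x.2| < e / 2 ->
    `|((a, b) : H) - x| < e.
  move=> ax bx; apply: le_lt_trans (sum_norm_le _) _.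
  by rewrite [ltRHS]splitr ltrD.
by near=> x; apply: close; near: x.
Unshelve. all: by end_near. Qed.

HB.instance Definition _ := Uniform_isComplete.Build H hilbert_sum_complete.

Definition sum_inner (x y : H) : R[i] := inner x.1 y.1 + inner x.2 y.2.

Lemma sum_inner_bilinear :
  bilinear_for *%R (@Num.conj R[i] \; *%R) sum_inner.
Proof.
split=> [y a x x'|x a y y']; rewrite /sum_inner /=.
  by rewrite !linearPl mulrDr addrACA.
by rewrite !linearPr /= mulrDr addrACA.
Qed.

HB.instance Definition _ := bilinear_isBilinear.Build R[i] H H R[i]
  *%R (@Num.conj R[i] \; *%R) sum_inner sum_inner_bilinear.

Lemma sum_inner_hermitian (x y : H) :
  sum_inner x y = (-1) ^+ false * Num.conj (sum_inner y x).
Proof.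
rewrite /sum_inner mul1r rmorphD /=.
by rewrite (hermC inner x.1) (hermC inner x.2) /= !mul1r.
Qed.

HB.instance Definition _ := isHermitianSesquilinear.Build R[i] H false
  (@Num.conj R[i]) sum_inner sum_inner_hermitian.

Lemma sqr_norm_sum_inner (x : H) : `|x| ^+ 2 = sum_inner x x.
Proof. by rewrite /sum_inner -!sqr_norm_inner -sqr_sum_norm. Qed.

Lemma sum_inner_gt0 (x : H) : x != 0 -> 0 < sum_inner x x.
Proof. by move=> x0; rewrite -sqr_norm_sum_inner exprn_gt0// normr_gt0. Qed.

HB.instance Definition _ :=
  isDotProduct.Build R[i] H sum_inner sum_inner_gt0.

HB.instance Definition _ :=
  CompleteNormedModule_isHilbert.Build R H sqr_norm_sum_inner.

End HilbertSum.

Definition bounded_operator (R : realType) (H K : hilbertType R)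
    (A : {linear H -> K}) : Prop :=
  exists M : R, forall x : H, `|A x| <= M%:C * `|x|.

Lemma bounded_operatorP (R : realType) (H K : hilbertType R)
    (A : {linear H -> K}) :
  bounded_operator A <-> bounded_near A (nbhs (0 : H)).
Proof.
rewrite linear_boundedP; split=> [[M AM]|].
  exists M%:C; split=> [|r Mr x]; first by rewrite realE !lecE /= eqxx le_total.
  by rewrite (le_trans (AM x))// ler_wpM2r// ltW.
move=> /pinfty_ex_gt0[r r0 Ar]; exists (complex.Re r) => x.
by rewrite RRe_real ?gtr0_real.
Qed.

Section OperatorSum.
Variables (R : realType) (H1 H2 : hilbertType R).
Variables (A1 : {linear H1 -> H1}) (A2 : {linear H2 -> H2}).

Definition operator_sum (x : hilbert_sum H1 H2) : hilbert_sum H1 H2 :=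
  (A1 x.1, A2 x.2).

Lemma operator_sum_linear : linear operator_sum.
Proof. by move=> a x y; rewrite /operator_sum /= !linearP. Qed.

HB.instance Definition _ := GRing.isLinear.Build R[i] (hilbert_sum H1 H2)
  (hilbert_sum H1 H2) *:%R operator_sum operator_sum_linear.

Lemma operator_sum_bounded :
  bounded_operator A1 -> bounded_operator A2 -> bounded_operator operator_sum.
Proof.
move=> [M1 AM1] [M2 AM2]; exists (`|M1| + `|M2|) => x.
have bound (H : hilbertType R) (A : {linear H -> H}) (M : R) (y : H) :
    (forall z, `|A z| <= M%:C * `|z|) -> `|y| <= `|x| ->
    `|A y| <= `|M|%:C * `|x|.
  move=> AM yx; apply: le_trans (AM y) _.
  rewrite (@le_trans _ _ (`|M|%:C * `|y|))//.
    by rewrite ler_wpM2r// lecR ler_norm.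
  by rewrite ler_wpM2l// ler0c.
rewrite rmorphD mulrDl; apply: le_trans (sum_norm_le _) _; apply: lerD.
  exact: bound (fst_le_sum_norm x).
exact: bound (snd_le_sum_norm x).
Qed.

End OperatorSum.

Definition separable_space (T : topologicalType) : Prop :=
  exists2 D : set T, countable D & dense D.

Definition infinite_dimensional (K : fieldType) (V : lmodType K) : Prop :=
  ~ exists (n : nat) (e : 'I_n -> V),
      forall v : V, exists c : 'I_n -> K, v = \sum_(i < n) c i *: e i.

Definition hypercyclic (R : realType) (H : hilbertType R)
    (A : {linear H -> H}) : Prop :=
  exists x : H, dense [set y | exists n : nat, y = iter n A x].

Definition diskcyclic (R : realType) (H : hilbertType R)
    (A : {linear H -> H}) : Prop :=
  exists x : H, dense [set y | exists (n : nat) (b : R[i]),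
    `|b| <= 1 /\ y = b *: iter n A x].

(* Main.v *)
Require Import Defs.
From mathcomp Require Import all_boot all_order all_algebra complex.
From mathcomp Require Import all_classical all_reals all_analysis.

Set Implicit Arguments.
Unset Strict Implicit.
Unset Printing Implicit Defensive.

Import Order.TTheory GRing.Theory Num.Theory.
Import numFieldNormedType.Exports.

Local Open Scope classical_set_scope.
Local Open Scope complex_scope.
Local Open Scope ring_scope.

(* Write A = T / alpha. Then b S^n (x, c) = s (A^n (x / c), 1) with
   s = b alpha^n c. If such a vector is close to (h, 1), then s is close to 1,
   so A^n (x / c) is close to h: a diskcyclic vector (x, c) of S gives the
   hypercyclic vector x / c of A. Conversely, let x be hypercyclic for A. To
   approximate (h, v) with v <> 0, take n with A^n x close to h / v and
   b = v / alpha^n; the constraint |b| <= 1 holds for large n because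
   alpha > 1, and n can be taken large because H has no isolated points. *)

Lemma dense_normP (K : numFieldType) (V : normedModType K) (D : set V) :
  dense D <-> forall (v : V) (e : K), 0 < e -> exists2 y, D y & `|v - y| < e.
Proof.
split=> [Dd v e e0|De U [v Uv] oU].
  have [|y [vy Dy]] := Dd (ball v e) _ (ball_open v e).
    by exists v; exact: ballxx.
  by exists y => //; move: vy; rewrite -ball_normE.
have /nbhs_ballP[e /= e0 eU] : nbhs v U by apply: open_nbhs_nbhs.
have [y Dy vy] := De v e e0.
by exists y; split=> //; apply: eU; rewrite -ball_normE.
Qed.

(** The nonzero [u] gives a direction in which to step off [p] by a distance of [e / 2]. *)
Lemma dense_setC1 (K : numFieldType) (V : normedModType K) (u p : V) :
  u != 0 -> dense [set~ p].
Proof.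
move=> u0; apply/dense_normP => v e e0.
have nu0 : 0 < `|u| by rewrite normr_gt0.
have [vp|vp] := pselect (v = p); last by exists v; rewrite // subrr normr0.
have c0 : 0 < e / 2 / `|u| by rewrite !divr_gt0.
exists (v + (e / 2 / `|u|) *: u).
  move=> /= /eqP; rewrite vp -subr_eq0 addrAC subrr add0r scaler_eq0.
  by rewrite (negPf u0) orbF gt_eqF.
rewrite opprD addrA subrr sub0r normrN normrZ gtr0_norm// divfK ?gt_eqF//.
by rewrite gtr_pMr// invf_lt1 ?ltr1n.
Qed.

(** The complement of [p] is open, since points are closed, and dense; a dense set stays dense when
    intersected with an open dense set. *)
Lemma dense_setD1 (K : numFieldType) (V : normedModType K) (D : set V)
    (u p : V) :
  u != 0 -> dense D -> dense (D `\ p).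
Proof.
move=> u0 Dd; rewrite setDE setIC.
apply: denseI => //; last exact: dense_setC1 u0.
apply: closed_openC; apply: accessible_closed_set1.
exact/hausdorff_accessible/norm_hausdorff.
Qed.

(** Raising [N] by one loses at most the point [a N], so density survives by induction. This lets an
    approximating iterate be taken with large index. *)
Lemma dense_tail (K : numFieldType) (V : normedModType K) (u : V)
    (a : nat -> V) (N : nat) :
  u != 0 -> dense (range a) -> dense [set a n | n in [set n | (N <= n)%N]].
Proof.
move=> u0 ad; elim: N => [|N IH].
  by rewrite (_ : [set n | _] = setT)// predeqE.
move=> U U0 oU; have [z [Uz [[n /= Nn nz] zN]]] := dense_setD1 (a N) u0 IH U0 oU.
exists z; split=> //; exists n => //=; rewrite ltn_neqAle Nn andbT.
by apply: contra_notN zN => /eqP Nn'; rewrite -nz Nn'.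
Qed.

Lemma infinite_dimensional_neq0 (K : fieldType) (V : lmodType K) :
  infinite_dimensional V -> exists u : V, u != 0.
Proof.
move=> Vinf; apply: contra_notP Vinf => V0.
(* If there were no nonzero vector, the empty family would span [V]. *)
exists 0%N, (fun=> 0) => v; exists (fun=> 0); rewrite big_ord0.
by apply: contra_notP V0 => /eqP v0; exists v.
Qed.

Lemma iter_scale (K : comNzRingType) (V : lmodType K) (a : K)
    (A : {linear V -> V}) (n : nat) (x : V) :
  iter n (a \*: A) x = a ^+ n *: iter n A x.
Proof.
elim: n => [|n IH]; first by rewrite scale1r.
by rewrite !iterS IH /= linearZ /= scalerA -exprS.
Qed.

Lemma iter_linearZ (K : comNzRingType) (V : lmodType K) (A : {linear V -> V})
    (n : nat) (a : K) (x : V) :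
  iter n A (a *: x) = a *: iter n A x.
Proof. by elim: n => //= n ->; rewrite linearZ. Qed.

Lemma iter_operator_sum (R : realType) (H1 H2 : hilbertType R)
    (A1 : {linear H1 -> H1}) (A2 : {linear H2 -> H2}) (n : nat)
    (x : hilbert_sum H1 H2) :
  iter n (operator_sum A1 A2) x = (iter n A1 x.1, iter n A2 x.2).
Proof. by elim: n => [|n IH]; [case: x | rewrite !iterS IH]. Qed.

Lemma iter_homothety (R : realType) (a : R[i]) (n : nat) (c : complex_line R) :
  iter n (a \*: @idfun (complex_line R)) c = a ^+ n *: c.
Proof. by elim: n => [|n IH]; rewrite ?scale1r//= IH scalerA -exprS. Qed.

Lemma eventually_norm_expV_le1 (R : realType) (alpha : R) (w : R[i]) :
  1 < alpha -> exists N, forall n, (N <= n)%N ->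
  `|w * (alpha%:C)^-1 ^+ n| <= 1.
Proof.
move=> a1; have a0 : 0 < alpha by exact: lt_trans a1.
have aV1 : `|alpha^-1| < 1 by rewrite gtr0_norm ?invr_gt0// invf_lt1.
(* The real geometric sequence [|w| / alpha ^ n] tends to 0, hence is eventually below 1. *)
have /cvgr0_norm_lt/(_ _ ltr01)[N _ HN] :=
  @cvg_geometric _ (complex.Re `|w|) _ aV1.
exists N => n Nn; have -> : w * (alpha%:C)^-1 ^+ n = w * ((alpha^-1) ^+ n)%:C.
  by rewrite rmorphXn fmorphV.
have q0 : 0 <= alpha^-1 ^+ n by rewrite exprn_ge0// invr_ge0 ltW.
rewrite normrM -[`|w|]RRe_real ?normr_real// [`|_%:C|]ger0_norm ?ler0c//.
rewrite -rmorphM -(rmorph1 (real_complex R)) lecR.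
by apply: le_trans (ler_norm _) _; apply: ltW; exact: HN.
Qed.

(** The tolerance [d] is fixed before [s] and [v] are known. As [s (h - v) = (h - s v) - (1 - s) h]
    has norm less than [d + d |h| = (1 - d) e], and [|s| > 1 - d], dividing by [|s|] gives the bound
    [e]. *)
Lemma unscale_near (K : numFieldType) (V : normedModType K) (h : V) (e : K) :
  0 < e -> exists2 d, 0 < d & forall s : K, `|1 - s| < d ->
    s != 0 /\ forall v : V, `|h - s *: v| < d -> `|h - v| < e.
Proof.
move=> e0; have h1 : 0 < 1 + `|h| by rewrite ltr_pwDl.
have he : 0 < 1 + `|h| + e by rewrite addr_gt0.
(* The solution of [d * (1 + `|h|) = (1 - d) * e]. *)
pose d := e / (1 + `|h| + e).
exists d => [|s sd]; first by rewrite divr_gt0.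
have d1 : d < 1 by rewrite ltr_pdivrMr// mul1r ltrDr.
have ds : 1 - d < `|s|.
  rewrite ltrBlDr -ltrBlDl; apply: le_lt_trans sd.
  by rewrite -{1}(normr1 K) lerB_dist.
have s0 : 0 < `|s| by apply: lt_trans ds; rewrite subr_gt0.
split=> [|v hd]; first by rewrite -normr_gt0.
rewrite -(ltr_pM2l s0) -normrZ scalerBr.
have -> : s *: h - s *: v = (h - s *: v) - (1 - s) *: h.
  by rewrite scalerBl scale1r opprB addrACA addrC addrA subrK addrC.
apply: (@lt_trans _ _ ((1 - d) * e)); last by rewrite ltr_pM2r.
have -> : (1 - d) * e = d + d * `|h|.
  have dE : d * (1 + `|h| + e) = e by rewrite divfK// gt_eqF.
  by rewrite mulrBl mul1r -{1}dE !mulrDr mulr1 addrK.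
rewrite (le_lt_trans (ler_normB _ _))// ltr_leD// normrZ.
by rewrite ler_wpM2r// ltW.
Qed.

(** Moves the second coordinate of a target off 0, so that the first can be divided by it. *)
Lemma exists_neq0_near (K : numFieldType) (w e : K) :
  0 < e -> exists2 w', w' != 0 & `|w - w'| < e.
Proof.
move=> e0; have /dense_normP/(_ w e e0)[w' /eqP w'0 ww'] :=
  @dense_setC1 K K^o 1 0 (oner_neq0 _).
by exists w'.
Qed.

Lemma iter_unscale (K : fieldType) (V : lmodType K) (a : K)
    (T : {linear V -> V}) (n : nat) (x : V) :
  a != 0 -> iter n T x = a ^+ n *: iter n (a^-1 \*: T) x.
Proof.
by move=> a0; rewrite iter_scale exprVn scalerA divff ?expf_neq0// scale1r.
Qed.

Lemma diskcyclic_hypercyclic (R : realType) (H : hilbertType R)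
    (T : {linear H -> H}) (a : R[i]) :
  a != 0 -> diskcyclic (operator_sum T (a \*: @idfun (complex_line R))) ->
  hypercyclic (a^-1 \*: T).
Proof.
(* The inverse is total, so this witness can be given now; [c != 0] follows later from [s != 0]. *)
move=> a0 [[x c] /dense_normP Sd]; exists ((c : R[i])^-1 *: x).
apply/dense_normP => h e e0.
have [d d0 near_h] := unscale_near h e0.
have [_ [n [b [_ ->]]] near_h1] := Sd (h, 1 : R[i]) _ d0.
exists (iter n (a^-1 \*: T) ((c : R[i])^-1 *: x)); first by exists n.
move: near_h1; rewrite iter_operator_sum iter_homothety => near_h1.
(* The second coordinate of the orbit point, which lies within [d] of 1. *)
pose s : R[i] := b * (a ^+ n * c).
have hd : `|h - b *: iter n T x| < d.
  exact: le_lt_trans (fst_le_sum_norm _) near_h1.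
have [s0 near_v] : s != 0 /\ forall v, `|h - s *: v| < d -> `|h - v| < e.
  by apply: near_h; exact: le_lt_trans (snd_le_sum_norm _) near_h1.
have c0 : (c : R[i]) != 0.
  by apply: contraNneq s0; rewrite /s => ->; rewrite !mulr0.
apply: near_v; suff <- : b *: iter n T x =
  s *: iter n (a^-1 \*: T) ((c : R[i])^-1 *: x) by [].
rewrite (iter_unscale _ _ _ a0) iter_linearZ !scalerA /s.
by rewrite -!mulrA mulfV// mulr1.
Qed.

Lemma hypercyclic_diskcyclic (R : realType) (H : hilbertType R)
    (T : {linear H -> H}) (alpha : R) :
  (exists u : H, u != 0) -> 1 < alpha -> hypercyclic ((alpha%:C)^-1 \*: T) ->
  diskcyclic (operator_sum T (alpha%:C \*: @idfun (complex_line R))).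
Proof.
set a := alpha%:C => -[u u0] alpha1 [x Ad]; exists (x, 1 : R[i]).
have a0 : a != 0 by rewrite fmorph_eq0 gt_eqF// (lt_trans ltr01).
have {}Ad : dense (range (fun n => iter n (a^-1 \*: T) x)).
  move=> U U0 oU; have [y [Uy [n yE]]] := Ad U U0 oU.
  by exists y; split=> //; exists n.
apply/dense_normP => -[h w] e e0; have e20 : 0 < e / 2 by rewrite divr_gt0.
have [v v0 wv] := exists_neq0_near (w : R[i]) e20.
have [N vN] := eventually_norm_expV_le1 v alpha1.
have /dense_normP An := dense_tail N u0 Ad.
(* Multiplying back by [v] turns this tolerance into [e / 2] for the first coordinate; the other
   half covers [|w - v|]. *)
have d0 : 0 < e / 2 / `|v| by rewrite divr_gt0 ?normr_gt0.
have [_ [n /= Nn <-] hn] := An (v^-1 *: h) _ d0.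
exists ((v * a^-1 ^+ n) *: iter n
    (operator_sum T (a \*: @idfun (complex_line R))) (x, 1 : R[i])).
  by exists n, (v * a^-1 ^+ n); split=> //; exact: vN.
(* Thus the second coordinate of the chosen point is exactly [v], and the first is [v] times the
   iterate of [a^-1 \*: T]. *)
have van : v * a^-1 ^+ n * a ^+ n = v.
  by rewrite -mulrA exprVn mulVf ?mulr1// expf_neq0.
rewrite iter_operator_sum iter_homothety (iter_unscale _ _ _ a0).
apply: le_lt_trans (sum_norm_le _) _; rewrite [ltRHS]splitr /=.
apply: ltrD; last by rewrite -[_ *: _]/(v * a^-1 ^+ n * (a ^+ n * 1)) mulr1 van.
rewrite scalerA van -(ltr_pM2r (x := `|v|^-1)) ?invr_gt0 ?normr_gt0//.
by rewrite mulrC -normfV -normrZ scalerBr scalerA mulVf// scale1r normfV.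
Qed.

Theorem theorem2p4 (R : realType) (H : hilbertType R) (T : {linear H -> H})
    (alpha : R) :
  infinite_dimensional H -> separable_space H -> bounded_operator T ->
  1 < alpha ->
  diskcyclic (operator_sum T (alpha%:C \*: @idfun (complex_line R))) <->
  hypercyclic ((alpha%:C)^-1 \*: T).
Proof.
move=> Hinf _ _ alpha1; split.
  by apply: diskcyclic_hypercyclic; rewrite fmorph_eq0 gt_eqF// (lt_trans ltr01).
exact: hypercyclic_diskcyclic (infinite_dimensional_neq0 Hinf) alpha1.
Qed.
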